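(* Let $g,n,r$ be integers with $0\le r<n$ and $2n\le g-1$. Let $C$ be a hyperelliptic ribbon of genus $g$ on $\mathbb P^1$. Then $W^r_{2n}(C)=\{L\in\mathrm{Pic}^{2n}(C): h^0(C,L)\ge r+1\}$, viewed as a closed algebraic subset of $\mathrm{Pic}^{2n}(C)\cong\mathbb A^g$, is isomorphic to the (affine) cone in $\mathbb A^g$ over $S_{n-r}\subset\mathbb P^{g-1}$, where $S_m$ denotes the union of the $m$-secant $(m-1)$-planes to a rational normal curve of degree $g-1$ in $\mathbb P^{g-1}$. In particular, $W^r_{2n}(C)$ has dimension equal to $2n-2r$.
   Context: Work over an algebraically closed field $k$ of characteristic $0$. A ribbon on $\mathbb P^1$ is a scheme $C$ with an isomorphism $\mathbb P^1\to C_{red}$ such that the ideal sheaf $\mathscr L$ of $\mathbb P^1$ in $C$ satisfies $\mathscr L^2=0$ and is (as a sheaf on $\mathbb P^1$) a line bundle. Its genus is $g=1-\chi(\mathscr O_C)$; equivalently $\mathscr L\cong\mathscr O_{\mathbb P^1}(-g-1)$. $C$ is hyperelliptic (or split) if there is a morphism $C\to\mathbb P^1$ restricting to the identity on $\mathbb P^1\cong C_{red}$. The degree of a line bundle $L$ is $\chi(L)-\chi(\mathscr O_C)$; if $L|_{\mathbb P^1}\cong\mathscr O_{\mathbb P^1}(n)$ then $\deg L=2n$. Coordinates on $\mathrm{Pic}^{2n}(C)$: a hyperelliptic ribbon of genus $g$ is the gluing of $U_1=\operatorname{Spec}k[s,\epsilon]/\epsilon^2$ and $U_2=\operatorname{Spec}k[t,\eta]/\eta^2$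 via $\epsilon=t^{-g-1}\eta$, $s^{-1}=t$. A degree $2n$ line bundle is given by free generators $e_i$ on $U_i$ with $e_1=t^n(1+G\eta)e_2$ on $U_1\cap U_2$, and isomorphism classes correspond bijectively to $G=\sum_{j=1}^gG_jt^{-j}$ with $(G_1,\dots,G_g)\in\mathbb A^g$. $m$-secant $(m-1)$-planes are the linear spans of length-$m$ subschemes of the rational normal curve (so that $S_m$ is closed). *)

(* Defs.v *)
From HB Require Import structures.
From mathcomp Require Import all_boot all_order all_algebra.
From mathcomp Require Import mpoly.

Set Implicit Arguments.
Unset Strict Implicit.
Unset Printing Implicit Defensive.

Import GRing.Theory.
Local Open Scope ring_scope.

Definition lin_indep (k : fieldType) (V : lmodType k) (d : nat)
    (s : 'I_d -> V) : Prop :=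
  forall c : 'I_d -> k, \sum_(i < d) c i *: s i = 0 -> forall i, c i = 0.

(* The k-linear subspace P of V has dimension at least d; V itself is allowed
   to be infinite-dimensional. *)
Definition dim_ge (k : fieldType) (V : lmodType k) (P : V -> Prop)
    (d : nat) : Prop :=
  exists2 s : 'I_d -> V, (forall i, P (s i)) & lin_indep s.

(** * The hyperelliptic ribbon of genus g *)

(* Elements x + y eta of A[eta]/(eta^2) are encoded as pairs (x, y) : A * A.
   Their product is [dmul]; it is NOT the componentwise product which the
   library puts on A * A. *)
Definition dmul (A : comPzRingType) (x y : A * A) : A * A :=
  (x.1 * y.1, x.1 * y.2 + x.2 * y.1).

(* The ring k[t, t^-1][eta]/(eta^2) of U_1 :&: U_2 is handled inside
   k(t)[eta]/(eta^2), into which it injects. *)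
Definition tvar (k : fieldType) : {fraction {poly k}} := tofrac ('X : {poly k}).

Definition constF (k : fieldType) (c : k) : {fraction {poly k}} := tofrac c%:P.

(* p(s) |-> p(t^-1) *)
Definition subst_tinv (k : fieldType) (p : {poly k}) : {fraction {poly k}} :=
  (map_poly (@constF k) p).[(tvar k)^-1].

(* Restriction of a_0(s) + a_1(s) epsilon from U_1, where s = t^-1 and
   epsilon = t^(-g-1) eta. *)
Definition restr1 (k : fieldType) (g : nat) (a : {poly k} * {poly k}) :
    {fraction {poly k}} * {fraction {poly k}} :=
  (subst_tinv a.1, subst_tinv a.2 * tvar k ^- g.+1).

(* Restriction of b_0(t) + b_1(t) eta from U_2. *)
Definition restr2 (k : fieldType) (b : {poly k} * {poly k}) :
    {fraction {poly k}} * {fraction {poly k}} :=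
  (tofrac b.1, tofrac b.2).

(* The unit u = t^n (1 + G eta), with G = \sum_(1 <= j <= g) G_j t^-j.  The
   coordinate G_j is the entry of index j - 1 of the row vector. *)
Definition transition (k : fieldType) (g n : nat) (G : 'rV[k]_g) :
    {fraction {poly k}} * {fraction {poly k}} :=
  dmul (tvar k ^+ n, 0)
       (1, \sum_(j < g) constF (G 0 j) * tvar k ^- j.+1).

(* H^0(C, L) for L glued by e_1 = u e_2: the pairs (a, b) of a section a e_1
   over U_1 and a section b e_2 over U_2 which agree on the overlap. *)
Definition global_section (k : fieldType) (g : nat)
    (u : {fraction {poly k}} * {fraction {poly k}})
    (ab : ({poly k} * {poly k}) * ({poly k} * {poly k})) : Prop :=
  dmul (restr1 g ab.1) u = restr2 ab.2.

(* W^r_{2n}(C), in the coordinates G on Pic^{2n}(C) = A^g. *)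
Definition BN_locus (k : fieldType) (g n r : nat) (G : 'rV[k]_g) : Prop :=
  dim_ge (global_section g (transition n G)) r.+1.

(** * Algebraic subsets of affine space *)

Definition peval (k : fieldType) (q : nat) (p : {mpoly k[q]})
    (v : 'rV[k]_q) : k :=
  p.@[fun i => v 0 i].

Definition zariski_closed (k : fieldType) (q : nat)
    (Z : 'rV[k]_q -> Prop) : Prop :=
  exists I : {mpoly k[q]} -> Prop,
    forall v, Z v <-> (forall p, I p -> peval p v = 0).

Definition polymap (k : fieldType) (p q : nat)
    (phi : 'I_q -> {mpoly k[p]}) (v : 'rV[k]_p) : 'rV[k]_q :=
  \row_(j < q) peval (phi j) v.

(* Isomorphism of algebraic sets: polynomial maps between the ambient affine
   spaces restrict to mutually inverse bijections.  If one of X, Y is closed,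
   so is the other. *)
Definition alg_iso (k : fieldType) (p q : nat)
    (X : 'rV[k]_p -> Prop) (Y : 'rV[k]_q -> Prop) : Prop :=
  exists (phi : 'I_q -> {mpoly k[p]}) (psi : 'I_p -> {mpoly k[q]}),
    (forall x, X x -> Y (polymap phi x) /\ polymap psi (polymap phi x) = x) /\
    (forall y, Y y -> X (polymap psi y) /\ polymap phi (polymap psi y) = y).

Definition subset_of (k : fieldType) (q : nat)
    (X Y : 'rV[k]_q -> Prop) : Prop :=
  forall v, X v -> Y v.

Definition irreducible_set (k : fieldType) (q : nat)
    (Z : 'rV[k]_q -> Prop) : Prop :=
  (exists v, Z v) /\
  forall A B : 'rV[k]_q -> Prop, zariski_closed A -> zariski_closed B ->
    subset_of Z (fun v => A v \/ B v) -> subset_of Z A \/ subset_of Z B.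

(* Z 0 < Z 1 < ... < Z d is a strictly increasing chain of irreducible closed
   subsets of the closed set W. *)
Definition irreducible_chain (k : fieldType) (q : nat)
    (W : 'rV[k]_q -> Prop) (d : nat) (Z : nat -> 'rV[k]_q -> Prop) : Prop :=
  (forall i, (i <= d)%N ->
     [/\ zariski_closed (Z i), irreducible_set (Z i) & subset_of (Z i) W]) /\
  (forall i, (i < d)%N ->
     subset_of (Z i) (Z i.+1) /\ ~ subset_of (Z i.+1) (Z i)).

(* The Krull dimension of the closed set W is d. *)
Definition has_dimension (k : fieldType) (q : nat)
    (W : 'rV[k]_q -> Prop) (d : nat) : Prop :=
  (exists Z, irreducible_chain W d Z) /\
  (forall e Z, irreducible_chain W e Z -> (e <= d)%N).

(** * Secant varieties of rational normal curves *)

(* A rational normal curve of degree g - 1 in P^(g-1), given as the image of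
   [x : y] |-> [F_0(x, y) : ... : F_(g-1)(x, y)], where F is a basis of the
   (g-dimensional) space of binary forms of degree g - 1. *)
Definition rational_normal_curve (k : fieldType) (g : nat)
    (F : 'I_g -> {mpoly k[2]}) : Prop :=
  (forall i, F i \is (g - 1)%N.-homog) /\ lin_indep F.

(* Subsets of P^(g-1) are given by the homogeneous coordinate vectors of their
   points.  A closed subscheme of length m of the curve, identified with P^1
   through F, is the zero scheme of a nonzero binary form f of degree m.  The
   hyperplane \sum_i h_i x_i = 0 contains it iff f divides \sum_i h_i F_i, and
   its linear span is the intersection of all hyperplanes which contain it. *)
Definition in_span (k : fieldType) (g : nat) (F : 'I_g -> {mpoly k[2]})
    (f : {mpoly k[2]}) (v : 'rV[k]_g) : Prop :=
  forall h : 'I_g -> k,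
    (exists q : {mpoly k[2]}, \sum_(i < g) h i *: F i = f * q) ->
    \sum_(i < g) h i * v 0 i = 0.

(* S_m *)
Definition secant_variety (k : fieldType) (g : nat)
    (F : 'I_g -> {mpoly k[2]}) (m : nat) (v : 'rV[k]_g) : Prop :=
  v != 0 /\
  exists f : {mpoly k[2]}, [/\ f != 0, f \is m.-homog & in_span F f v].

Definition affine_cone (k : fieldType) (g : nat) (S : 'rV[k]_g -> Prop)
    (v : 'rV[k]_g) : Prop :=
  v = 0 \/ exists (c : k) (w : 'rV[k]_g), S w /\ v = c *: w.

(* Main.v *)
(* Clearing denominators, a section of the line bundle with coordinates [G] is a
   polynomial [b] of degree at most [n] such that [b * G] has no terms in
   [t^-1], ..., [t^-(g - n)]: an element of the kernel of a Hankel matrix of [G],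
   or a form of degree [n] apolar to the functional [X^i |-> G_(i + 1)] on forms
   of degree [g - 1].  Passing from degree [d] to degree [d - 1] lowers the
   dimension of the space of apolar forms by at most one as long as
   [2 * d <= g], so [h^0 >= r + 1] means that there is a nonzero apolar form of
   degree [m = n - r].  Its zero scheme is the length [m] subscheme of the
   rational normal curve whose span contains [G].

   A nonzero apolar form of degree [m] is a linear recurrence satisfied by [G];
   its coefficients and the initial terms cover the locus by finitely many
   polynomial images of affine space of dimension [2 * m].  A chain of length
   [e] of irreducible closed subsets gives [e] algebraically independent
   functions, whence [e <= 2 * m] by counting monomials; the closures of the
   images of a coordinate flag give a chain of length [2 * m]. *)

Require Import Defs.
From HB Require Import structures.
From mathcomp Require Import all_boot all_order all_algebra.
From mathcomp Require Import mpoly.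
From mathcomp Require Import zify ring.
From Stdlib Require Import Classical.

Set Implicit Arguments.
Unset Strict Implicit.
Unset Printing Implicit Defensive.

Import GRing.Theory.
Local Open Scope ring_scope.

(** * Apolar forms *)

Lemma finite_choice (T : Type) (d : nat) (P : 'I_d -> T -> Prop) :
  (forall i, exists x, P i x) -> exists f : 'I_d -> T, forall i, P i (f i).
Proof.
elim: d P => [|d IHd] P exP.
  have f : 'I_0 -> T by case.
  by exists f => -[].
have [x Px] := exP ord0.
have [f Pf] := IHd (fun i => P (lift ord0 i)) (fun i => exP (lift ord0 i)).
exists (fun i => if unlift ord0 i is Some j then f j else x) => i.
by case: unliftP => [j|] ->.
Qed.

Section DimGe.
Variable k : fieldType.

Lemma dim_ge_transfer (V W : lmodType k) (P : V -> Prop) (Q : W -> Prop)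
    (pr : {linear V -> W}) d :
  (forall c x y, P x -> P y -> P (c *: x + y)) -> P 0 ->
  (forall x, P x -> Q (pr x)) -> (forall x, P x -> pr x = 0 -> x = 0) ->
  (forall y, Q y -> exists2 x, P x & pr x = y) ->
  dim_ge P d <-> dim_ge Q d.
Proof.
move=> Plin P0 PQ prI QP; split=> [[s Ps sI]|[s Qs sI]].
  exists (fun i => pr (s i)) => [i|c]; first exact: PQ.
  move=> c0; apply: sI; apply: prI.
    by elim/big_rec: _ => // i x _; apply: Plin.
  by rewrite linear_sum; under eq_bigr => i _ do rewrite linearZ.
have exf i : exists x, P x /\ pr x = s i by have [x] := QP _ (Qs i); exists x.
have [f Pf] := finite_choice exf.
exists f => [i|c c0]; first by case: (Pf i).
apply: sI; have := congr1 pr c0; rewrite linear_sum linear0.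
by under eq_bigr => i _ do rewrite linearZ (Pf i).2.
Qed.

(** Gaussian elimination: a vector of the family on which [phi] is nonzero serves as pivot to
    correct the others; if there is none, any vector may be dropped. *)
Lemma dim_ge_hyperplane (V : lmodType k) (P : V -> Prop)
    (phi : V -> k) d :
  (forall c x y, P x -> P y -> P (c *: x + y)) ->
  (forall c x y, P x -> P y -> phi (c *: x + y) = c * phi x + phi y) ->
  dim_ge P d.+1 -> dim_ge (fun x => P x /\ phi x = 0) d.
Proof.
move=> Plin philin [s Ps sI].
have [/existsP[i0 nz]|/existsPn phi0] := boolP [exists i, phi (s i) != 0]; last first.
  exists (fun i => s (lift ord0 i)) => [i|c c0 i].
    by split=> //; apply/eqP; rewrite -[_ == _]negbK phi0.
  have := sI (fun i => if unlift ord0 i is Some j then c j else 0).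
  rewrite big_ord_recl unlift_none scale0r add0r => sI'.
  have -> : c i = if unlift ord0 (lift ord0 i) is Some j then c j else 0.
    by rewrite liftK.
  by apply: sI'; rewrite -[RHS]c0; apply: eq_bigr => j _; rewrite liftK.
pose a i := - (phi (s (lift i0 i)) / phi (s i0)).
exists (fun i => a i *: s i0 + s (lift i0 i)) => [i|c c0 i].
  split; first exact: Plin.
  by rewrite philin // /a mulNr divfK // addNr.
have := sI (fun i => if unlift i0 i is Some j then c j else \sum_j c j * a j).
rewrite (bigD1_ord i0) //= unlift_none => sI'.
have -> : c i = if unlift i0 (lift i0 i) is Some j then c j else \sum_j c j * a j.
  by rewrite liftK.
apply: sI'; rewrite -[RHS]c0 scaler_suml -big_split /=; apply: eq_bigr => j _.
by rewrite liftK scalerDr scalerA.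
Qed.

End DimGe.

Section Apolar.
Variables (k : fieldType) (g : nat) (G : nat -> k).

(* The forms [b] of degree [d], dehomogenized, all of whose multiples of degree
   [g - 1] are killed by the functional ['X^i |-> G i]. *)
Definition apolar d (b : {poly k}) : Prop :=
  (size b <= d.+1)%N /\
  forall j, (j + d < g)%N -> \sum_(i < d.+1) b`_i * G (i + j) = 0.

Lemma apolar_lin d c x y : apolar d x -> apolar d y -> apolar d (c *: x + y).
Proof.
move=> [sx Hx] [sy Hy]; split.
  rewrite (leq_trans (size_polyD _ _)) // geq_max sy andbT.
  exact: leq_trans (size_scale_leq _ _) sx.
move=> j Hj; have := Hx j Hj; have := Hy j Hj.
have -> : \sum_(i < d.+1) (c *: x + y)`_i * G (i + j) =
   c * (\sum_(i < d.+1) x`_i * G (i + j)) + \sum_(i < d.+1) y`_i * G (i + j).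
  rewrite mulr_sumr -big_split /=; apply: eq_bigr => i _.
  by rewrite coefD coefZ mulrDl mulrA.
by move=> -> ->; rewrite mulr0 addr0.
Qed.

(* A form with [h_d != 0] reduces the missing condition on a form with
   [b_d = 0] to known ones; if there is no such [h], then nothing is lost by
   restricting to [b_d = 0], and the missing condition costs one dimension. *)
Lemma apolar_step d s : (2 * d.+1 <= g)%N ->
  dim_ge (apolar d.+1) s.+1 -> dim_ge (apolar d) s.
Proof.
move=> leg.
(* Once the top coefficient vanishes, only the condition at [j = g - d.+1] separates degree [d.+1]
   from degree [d]. *)
have sub b : apolar d.+1 b -> b`_d.+1 = 0 ->
   \sum_(i < d.+1) b`_i * G (i + (g - d.+1)) = 0 -> apolar d b.
  move=> [sb Hb] bd Hl; split.
    move: sb; rewrite leq_eqVlt => /orP[/eqP sb|//].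
    have /eqP : lead_coef b = 0 by rewrite lead_coefE sb.
    by rewrite lead_coef_eq0 => /eqP b0; rewrite b0 size_poly0 in sb.
  move=> j jd; have [jd1|jd1] := ltnP (j + d.+1) g.
    by have := Hb _ jd1; rewrite big_ord_recr /= bd mul0r addr0.
  by have -> : j = (g - d.+1)%N by lia.
have weaken (P Q : {poly k} -> Prop) : (forall x, P x -> Q x) -> dim_ge P s -> dim_ge Q s.
  by move=> PQ [f Pf fI]; exists f => // i; apply: PQ.
have [[h Kh hd]|noh] :=
  classic (exists2 h, apolar d.+1 h & h`_d.+1 != 0).
  move=> /(dim_ge_hyperplane (phi := fun b : {poly k} => b`_d.+1) (@apolar_lin d.+1)) H.
  have {}H := H (fun c x y _ _ => etrans (coefD _ _ _) (congr1 (+%R^~ _) (coefZ _ _ _))).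
  apply: weaken H => b [Kb bd]; apply: sub => //.
  apply: (mulfI hd); rewrite mulr0.
  (* [S] pairs [G] with a multiple of [b * h]. Summing over [l] first gives 0 by apolarity of [h].
     Summing over [i] first, apolarity of [b] leaves only [l = d.+1], which is [h_(d+1)] times the
     missing condition. The shift is a true difference by [leg]. *)
  pose S := \sum_(i < d.+1) \sum_(l < d.+2) b`_i * h`_l * G (i + l + (g - 2 * d.+1)).
  have S0 : S = 0.
    rewrite /S big1 // => i _.
    have lti : (i + (g - 2 * d.+1) + d.+1 < g)%N by have := ltn_ord i; lia.
    rewrite -[RHS](mulr0 b`_i) -[X in _ = _ * X](Kh.2 _ lti) mulr_sumr; apply: eq_bigr => l _.
    by rewrite mulrA; congr (_ * G _); lia.
  rewrite -[RHS]S0 /S [RHS]exchange_big [RHS]big_ord_recr /= [X in _ = X + _]big1; last first.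
    move=> l _.
    have ltl : (l + (g - 2 * d.+1) + d.+1 < g)%N by have := ltn_ord l; lia.
    rewrite -[RHS](mulr0 h`_l) -[X in _ = _ * X](Kb.2 _ ltl) [in RHS]big_ord_recr /=.
    rewrite bd mul0r addr0 mulr_sumr; apply: eq_bigr => i _.
    by rewrite [_ * h`_l]mulrC mulrA; congr (_ * _ * G _); lia.
  rewrite add0r mulr_sumr; apply: eq_bigr => i _.
  by rewrite [_ * h`_ _]mulrC mulrA; congr (_ * _ * G _); lia.
pose phi (b : {poly k}) := \sum_(i < d.+1) b`_i * G (i + (g - d.+1)).
move=> /(dim_ge_hyperplane (phi := phi) (@apolar_lin d.+1)) H.
apply: weaken (H _) => [b [Kb pb]|c x y _ _].
  apply: sub => //; apply/eqP/negPn/negP => bd; apply: noh; by exists b.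
rewrite /phi mulr_sumr -big_split /=; apply: eq_bigr => i _.
by rewrite coefD coefZ mulrDl mulrA.
Qed.

Lemma apolar_mulXn d e b : apolar d b -> apolar (d + e) (b * 'X^e).
Proof.
move=> [sb Hb]; split.
  rewrite (leq_trans (size_polyMleq _ _)) // size_polyXn addnS /=.
  by rewrite -addSn leq_add2r.
move=> j Hj; have ej : (e + j + d < g)%N by lia.
rewrite -[RHS](Hb _ ej).
rewrite -(big_mkord xpredT (fun i => (b * 'X^e)`_i * G (i + j))).
rewrite (big_cat_nat (n := e)) //=; last by lia.
rewrite big_nat big1 ?add0r => [|i /andP[_ ie]]; last by rewrite coefMXn ie mul0r.
rewrite -{1}[e]add0n big_addn (_ : (_ - e = d.+1)%N); last by lia.
rewrite big_mkord; apply: eq_bigr => i _.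
by rewrite coefMXn ltnNge leq_addl /= addnK addnA.
Qed.

(** In homogeneous terms this is multiplication by the [e]-th power of the variable that was set to
    1. *)
Lemma apolarW d e b : apolar d b -> apolar (d + e) b.
Proof.
move=> [sb Hb]; split; first by rewrite (leq_trans sb) // ltnS leq_addr.
move=> j Hj; rewrite -addSn big_split_ord /= Hb; last by lia.
rewrite add0r big1 // => i _; rewrite nth_default ?mul0r //.
by rewrite (leq_trans sb) // leq_addr.
Qed.

(* The rank loci of the Hankel matrices of a sequence do not depend on the
   shape of the matrix. *)
Lemma dim_ge_apolar m r : (2 * (m + r) <= g)%N ->
  dim_ge (apolar (m + r)) r.+1 <-> exists2 f, f != 0 & apolar m f.
Proof.
move=> leg; split=> [H|[f nz Kf]].
  have {H} [s Ks sI] : dim_ge (apolar m) 1.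
    elim: r leg H => [|r IHr]; first by rewrite addn0.
    by rewrite addnS => leg /(apolar_step leg); apply: IHr; lia.
  exists (s ord0) => //; apply/eqP => s0.
  have := sI (fun=> 1); rewrite big_ord1 s0 scaler0 => /(_ erefl ord0)/eqP.
  by rewrite oner_eq0.
(* Homogeneously, these are the products of [f] with the [r + 1] monomials of degree [r]. *)
exists (fun i : 'I_r.+1 => f * 'X^i) => [i|c c0 i].
  have -> : (m + r = m + i + (r - i))%N by have := ltn_ord i; lia.
  exact/apolarW/apolar_mulXn.
have /eqP : f * \poly_(i < r.+1) (if insub i is Some j then c j else 0) = 0.
  rewrite poly_def mulr_sumr -[RHS]c0; apply: eq_bigr => j _.
  by rewrite -scalerAr insubT // => ltj; congr (c _ *: _); apply: val_inj.
rewrite mulf_eq0 (negPf nz) /= => /eqP/(congr1 (fun p : {poly k} => p`_i)).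
by rewrite coef_poly ltn_ord coef0 insubT // => lti <-; congr c; apply: val_inj.
Qed.

End Apolar.

(** * Global sections *)

(** Natural number indices allow shifted sums without bound proofs. Index [i] holds the coordinate
    [G_(i + 1)] of the line bundle. *)
Definition coords (k : fieldType) g (G : 'rV[k]_g) (i : nat) : k :=
  if insub i is Some j then G 0 j else 0.

Lemma coords_ord (k : fieldType) g (G : 'rV[k]_g) (j : 'I_g) : coords G j = G 0 j.
Proof. by rewrite /coords valK. Qed.

Section Sections.
Variable k : fieldType.
Notation T := (tvar k).

Lemma tvar_neq0 : T != 0.
Proof. by rewrite tofrac_eq0 polyX_eq0. Qed.

Lemma constF_lin c x y : @constF k (c * x + y) = constF c * constF x + constF y.
Proof. by rewrite /constF polyCD polyCM tofracD tofracM. Qed.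

Lemma subst_tinv_wide (p : {poly k}) N : (size p <= N)%N ->
  subst_tinv p = \sum_(i < N) constF p`_i * T ^- i.
Proof.
have cF0 : @constF k 0 = 0 by rewrite /constF polyC0 tofrac0.
move=> leN; rewrite /subst_tinv (@horner_coef_wide _ N); last first.
  exact: leq_trans (size_poly _ _) leN.
by apply: eq_bigr => i _; rewrite coef_map_id0 // exprVn.
Qed.

Lemma subst_tinv_lin c (p q : {poly k}) :
  subst_tinv (c *: p + q) = constF c * subst_tinv p + subst_tinv q.
Proof.
pose N := maxn (size p) (size q).
have sp : (size p <= N)%N by rewrite leq_maxl.
have sq : (size q <= N)%N by rewrite leq_maxr.
have spq : (size (c *: p + q)%R <= N)%N.
  by rewrite (leq_trans (size_polyD _ _)) // geq_max sq
             (leq_trans (size_scale_leq _ _)).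
rewrite !(@subst_tinv_wide _ N) // mulr_sumr -big_split; apply: eq_bigr => i _.
by rewrite coefD coefZ constF_lin mulrDl mulrA.
Qed.

Lemma subst_tinvE (p : {poly k}) N : (size p <= N.+1)%N ->
  subst_tinv p * T ^+ N = tofrac (\poly_(i < N.+1) p`_(N - i)).
Proof.
move=> leN; rewrite (subst_tinv_wide leN) mulr_suml poly_def rmorph_sum /=.
rewrite (reindex_inj rev_ord_inj) /=; apply: eq_bigr => i _.
rewrite -mul_polyC tofracM tofracXn subSS -mulrA; congr (_ * _).
have lti := ltn_ord i; rewrite -[in T ^+ N](subnK (_ : i <= N)%N) // addnC exprD.
by rewrite mulrC mulfK // expf_neq0 // tvar_neq0.
Qed.

(** Together with [subst_tinv_size] this computes [H^0(O(n))] on the projective line. *)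
Lemma subst_tinv_surj n (b : {poly k}) : (size b <= n.+1)%N ->
  exists a, subst_tinv a * T ^+ n = tofrac b.
Proof.
move=> sb; exists (\poly_(i < n.+1) b`_(n - i)).
rewrite subst_tinvE ?size_poly //; congr tofrac; apply/polyP => i.
rewrite coef_poly ltnS; case: leqP => [lein|ltni].
  by rewrite coef_poly ltnS leq_subr subKn.
by rewrite nth_default // (leq_trans sb).
Qed.

Lemma subst_tinv_size n (a b : {poly k}) :
  subst_tinv a * T ^+ n = tofrac b -> (size b <= n.+1)%N.
Proof.
move=> /(congr1 (fun x => x * T ^+ size a)).
rewrite mulrAC (subst_tinvE (leqnSn _)) -!tofracXn -!tofracM => /eqP.
rewrite tofrac_eq => /eqP e; apply/leq_sizeP => j lenj.
have := congr1 (fun p : {poly k} => p`_(size a + j)) e.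
rewrite coefMXn [RHS]coefMXn [in RHS]ltnNge leq_addr /= addKn => <-.
rewrite coef_poly; case: ifP => // _; case: ifP => //; lia.
Qed.

(** The vanishing of [H^0(O(-d - 1))]: only powers [t^i] with [i <= 0] occur on the left and only
    those with [i > d] on the right. *)
Lemma subst_tinv_eq0 d (a b : {poly k}) :
  subst_tinv a = tofrac b * T ^+ d.+1 -> a = 0 /\ b = 0.
Proof.
move=> /(congr1 (fun x => x * T ^+ size a)).
rewrite (subst_tinvE (leqnSn _)) -!tofracXn -!tofracM => /eqP.
rewrite tofrac_eq => /eqP e.
have e' i := congr1 (fun p : {poly k} => p`_i) e.
have b0 : b = 0.
  apply/polyP => i; have := e' (size a + (d.+1 + i))%N; rewrite coef0.
  rewrite !coefMXn ltnNge leq_addr /= addKn ltnNge leq_addr /= addKn => <-.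
  rewrite coef_poly; case: ifP => //; lia.
split=> //; apply/polyP => i; rewrite coef0.
have [lti|] := ltnP i (size a); last by move/(nth_default _).
have := e' (size a - i)%N.
rewrite b0 !mul0r coef0 coef_poly ifT; last by lia.
by rewrite subKn // ltnW.
Qed.

Variables (g n : nat) (G : 'rV[k]_g).
Hypothesis ltng : (n < g)%N.

Let Gam : {poly k} := \poly_(j < g) coords G (g.-1 - j).

Lemma sum_tvarE : \sum_(j < g) constF (G 0 j) * T ^- j.+1 = tofrac Gam * T ^- g.
Proof.
rewrite /Gam poly_def rmorph_sum /= mulr_suml (reindex_inj rev_ord_inj) /=.
apply: eq_bigr => i _; have lti := ltn_ord i.
rewrite -mul_polyC tofracM tofracXn -mulrA -/T.
have -> : (g.-1 - i = rev_ord i)%N by rewrite /=; lia.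
rewrite coords_ord; congr (_ * _); have Tn := tvar_neq0.
apply: (mulIf (expf_neq0 g Tn)); rewrite divfK ?expf_neq0 //.
have -> : T ^+ g = T ^+ i * T ^+ (g - i.+1).+1.
  by rewrite -exprD; congr (_ ^+ _); lia.
by rewrite mulrCA mulVf ?mulr1 ?expf_neq0.
Qed.

Lemma coef_mul_Gam (b : {poly k}) l : (size b <= n.+1)%N -> (n <= l < g)%N ->
  (b * Gam)`_l = \sum_(i < n.+1) b`_i * coords G (i + (g.-1 - l)).
Proof.
move=> sb /andP[nl lg]; rewrite coefM.
have -> : l.+1 = (n.+1 + (l - n))%N by lia.
rewrite big_split_ord /= [X in _ + X]big1 ?addr0.
  apply: eq_bigr => i _; have lti := ltn_ord i; rewrite coef_poly ifT; last by lia.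
  by congr (_ * coords G _); lia.
by move=> i _; rewrite nth_default ?mul0r // (leq_trans sb) ?leq_addr.
Qed.

(** The second equation is the [eta]-component of the gluing condition, multiplied by [t^(g+1)] and
    simplified by the first; [Gam] is [t^g G]. *)
Lemma global_sectionE a0 a1 b0 b1 :
  global_section g (transition n G) ((a0, a1), (b0, b1)) <->
  subst_tinv a0 * T ^+ n = tofrac b0 /\
  subst_tinv a1 * T ^+ n = tofrac (b1 * 'X^(g.+1) - b0 * Gam * 'X).
Proof.
have Tn := tvar_neq0.
rewrite /global_section /transition /dmul /restr1 /restr2 /= mulr1 mul0r addr0.
rewrite sum_tvarE tofracB !tofracM tofracXn -/T.
have key : subst_tinv a0 * T ^+ n = tofrac b0 ->
  (subst_tinv a1 * T ^+ n = tofrac b1 * T ^+ g.+1 - tofrac b0 * tofrac Gam * T) <->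
  subst_tinv a0 * (T ^+ n * (tofrac Gam * T ^- g)) +
    subst_tinv a1 * T ^- g.+1 * T ^+ n = tofrac b1.
  move=> e0; rewrite !mulrA e0 (mulrAC (subst_tinv a1)).
  have -> : tofrac b0 * tofrac Gam / T ^+ g = tofrac b0 * tofrac Gam * T / T ^+ g.+1.
    by rewrite exprS invfM mulrA mulfK.
  rewrite -mulrDl; split=> [->|<-].
    by rewrite addrC subrK mulfK // expf_neq0.
  by rewrite divfK ?expf_neq0 // [X in _ = X - _]addrC addrK.
by split=> [[e0 e1]|[e0 e1]]; [split=> //; apply/(key e0)|congr pair => //; apply/(key e0)].
Qed.

(** The projection to [b_0] restricts a section to the reduced curve. It is injective because its
    kernel is [H^0(O(n - g - 1))], which vanishes for [n < g]. *)
Lemma BN_apolar r :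
  BN_locus n r G <-> dim_ge (apolar g (coords G) n) r.+1.
Proof.
pose pr : {linear (({poly k} * {poly k}) * ({poly k} * {poly k}))%type -> {poly k}} :=
  fst \o snd.
have Tn := tvar_neq0.
apply: (dim_ge_transfer (pr := pr)).
- move=> c [[x1 x2] [x3 x4]] [[y1 y2] [y3 y4]].
  move=> /global_sectionE [e1 e2] /global_sectionE [e3 e4].
  apply/global_sectionE; rewrite /= !subst_tinv_lin; split.
    by rewrite mulrDl -mulrA e1 e3 -tofracM -tofracD mul_polyC.
  rewrite mulrDl -mulrA e2 e4 -tofracM -tofracD; congr tofrac.
  by rewrite -!mul_polyC; ring.
- apply/global_sectionE; rewrite !mul0r subr0 tofrac0.
  by rewrite (@subst_tinv_wide 0 0) ?size_poly0 // big_ord0 mul0r.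
- move=> [[a0 a1] [b0 b1]] /global_sectionE [e1 e2]; rewrite /pr /=.
  have sb0 := subst_tinv_size e1; split=> // j jg.
  (* The coefficient of [t^(g - j)] is above the degree bound [n] and below the terms of
     [b1 * 'X^(g.+1)], so it only involves [b0 * Gam]. *)
  have gj : (n.+1 <= (g.-1 - j).+1)%N by lia.
  have /leq_sizeP/(_ _ gj) := subst_tinv_size e2.
  rewrite coefB coefMX coefMXn ltnS ifT; last by lia.
  rewrite sub0r coef_mul_Gam //=; last by lia.
  move=> /eqP; rewrite oppr_eq0 => /eqP e; rewrite -[RHS]e.
  by apply: eq_bigr => i _; congr (_ * coords G _); lia.
- move=> [[a0 a1] [b0 b1]] /global_sectionE [e1 e2]; rewrite /pr /= => b00.
  have /subst_tinv_eq0 : subst_tinv a0 = tofrac 0 * T ^+ 1.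
    by apply: (mulIf (expf_neq0 n Tn)); rewrite e1 b00 tofrac0 !mul0r.
  have /subst_tinv_eq0 : subst_tinv a1 = tofrac b1 * T ^+ (g - n).+1.
    apply: (mulIf (expf_neq0 n Tn)).
    rewrite e2 b00 !mul0r subr0 tofracM tofracXn -mulrA -exprD.
    by congr (_ * _ ^+ _); lia.
  by rewrite b00; case=> -> -> [-> _].
- move=> b0 [sb0 K].
  have [a0 e0] := subst_tinv_surj sb0.
  (* [b1] cancels the terms of [b0 * Gam * 'X] of degree above [g]; apolarity kills those of degree
     [n + 1] to [g]. *)
  pose b1 := drop_poly g (b0 * Gam).
  have [|a1 e1] := @subst_tinv_surj n (b1 * 'X^(g.+1) - b0 * Gam * 'X).
    apply/leq_sizeP => [[|l]] // lenl; rewrite coefB coefMX coefMXn ltnS /=.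
    case: ltnP => [ltlg|legl].
      by rewrite coef_mul_Gam // ?K ?subrr //; lia.
    by rewrite coef_drop_poly subSS subnK // subrr.
  by exists ((a0, a1), (b0, b1)) => //; apply/global_sectionE.
Qed.

End Sections.

(** * Hankel loci and binary forms *)

Section Closed.
Variables (k : fieldType) (q : nat).

(** The equations are the maximal minors; a choice [s] with a repeated column contributes the zero
    polynomial. *)
Lemma zariski_closed_singular d e (M : 'I_d -> 'I_e -> {mpoly k[q]}) :
  zariski_closed (fun v => exists2 c : 'rV[k]_d, c != 0 &
    c *m \matrix_(i, j) peval (M i j) v = 0).
Proof.
exists (fun p => exists s : 'I_d -> 'I_e, p = \det (\matrix_(i, j) M i (s j))) => v.
set N := \matrix_(i, j) _.
have detE (s : 'I_d -> 'I_e) :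
  peval (\det (\matrix_(i, j) M i (s j))) v = \det (colsub s N).
  rewrite /peval -det_map_mx; congr (\det _).
  by apply/matrixP => i j; rewrite !mxE.
split=> [[c nz cN] _ [s ->]|H].
  rewrite detE; apply/eqP; rewrite -[_ == 0]negbK -unitfE -unitmxE; apply/negP.
  move=> /mulmxK/(_ c); have -> : c *m colsub s N = colsub s (c *m N).
    by apply/matrixP => i j; rewrite !mxE; apply: eq_bigr => l _; rewrite !mxE.
  by rewrite cN mxsub_const mul0mx => c0; rewrite -c0 eqxx in nz.
have [Nfree|] := boolP (row_free N); last first.
  rewrite -kermx_eq0 => /rowV0Pn[c /sub_kermxP cN nz]; by exists c.
have fullT : row_full N^T by rewrite /row_full mxrank_tr.
have := fullrowsub_unit fullT.
have := H _ (ex_intro _ (fullrankfun fullT : 'I_d -> 'I_e) erefl).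
rewrite detE unitmxE -det_tr unitfE => det0.
suff -> : rowsub (fullrankfun fullT) N^T = (colsub (fullrankfun fullT) N)^T.
  by rewrite det0 eqxx.
by apply/matrixP => i j; rewrite !mxE.
Qed.

Definition mcoord (i : nat) : {mpoly k[q]} := if insub i is Some j then 'X_j else 0.

Lemma peval_mcoord i v : peval (mcoord i) v = coords v i.
Proof.
rewrite /peval /mcoord /coords; case: insub => [j|]; first by rewrite mevalXU.
by rewrite meval0.
Qed.

(** Dependence of the rows of a [d] by [e] Hankel matrix. Offset 0 gives the locus itself; positive
    offsets separate the steps of the flag in the lower bound. *)
Definition hankel_singular d e o (v : 'rV[k]_q) : Prop :=
  exists2 c : 'rV[k]_d, c != 0 &
    forall j, (j < e)%N -> \sum_(i < d) c 0 i * coords v (o + i + j) = 0.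

Lemma zariski_closed_hankel d e o : zariski_closed (hankel_singular d e o).
Proof.
have [I HI] := zariski_closed_singular (fun (i : 'I_d) (j : 'I_e) => mcoord (o + i + j)).
exists I => v; rewrite -HI; split=> [[c nz H]|[c nz H]]; exists c => //.
  apply/rowP => j; rewrite !mxE -[RHS](H j (ltn_ord j)); apply: eq_bigr => i _.
  by rewrite mxE peval_mcoord.
move=> j lej; have := congr1 (fun M : 'rV_e => M 0 (Ordinal lej)) H.
rewrite !mxE => e0; rewrite -[RHS]e0; apply: eq_bigr => i _.
by rewrite mxE peval_mcoord.
Qed.

Lemma hankel_singular_apolar m v : (m < q)%N ->
  hankel_singular m.+1 (q - m) 0 v <-> exists2 f, f != 0 & apolar q (coords v) m f.
Proof.
move=> ltm; split=> [[c nz H]|[f nz [sf H]]].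
  exists (rVpoly c); first by apply: contraNneq nz => c0; rewrite -(rVpolyK c) c0 linear0.
  split=> [|j jm]; first exact: size_poly.
  have jl : (j < q - m)%N by lia.
  by rewrite -[RHS](H j jl); apply: eq_bigr => i _; rewrite coef_rVpoly_ord add0n.
exists (poly_rV f) => [|j jl].
  by apply: contraNneq nz => c0; rewrite -(poly_rV_K sf) c0 linear0.
have jm : (j + m < q)%N by lia.
by rewrite -[RHS](H j jm); apply: eq_bigr => i _; rewrite mxE add0n.
Qed.

End Closed.

Section BinaryForms.
Variable k : fieldType.

(* [bimon d i] is the monomial [x^i y^(d - i)]. *)
Definition bimon d i : 'X_{1..2} := [multinom if j == ord0 then i else (d - i)%N | j < 2].

Lemma bimon_fst d i : bimon d i ord0 = i.
Proof. by rewrite mnmE. Qed.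

Lemma mdeg_bimon d i : (i <= d)%N -> mdeg (bimon d i) = d.
Proof. by move=> lei; rewrite mdegE big_ord_recr big_ord1 !mnmE /= subnKC. Qed.

Lemma mdeg_bimon_ord d (i : 'I_d.+1) : mdeg (bimon d i) = d.
Proof. by rewrite mdeg_bimon // -ltnS. Qed.

Lemma bimonE (x : 'X_{1..2}) : x = bimon (mdeg x) (x ord0).
Proof.
have dx : mdeg x = (x ord0 + x ord_max)%N.
  rewrite mdegE big_ord_recr big_ord1 /=.
  by congr (x _ + x _)%N; apply: val_inj.
apply/mnmP => j; rewrite mnmE dx.
have [->//|nz] := eqVneq j ord0; rewrite addKn; congr (x _).
by apply: val_inj; case: j nz => [[|[|]]].
Qed.

Lemma bimon_inj d i j : bimon d i = bimon d j -> i = j.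
Proof. by move=> e; rewrite -(bimon_fst d i) e bimon_fst. Qed.

Lemma binary_formE d (p : {mpoly k[2]}) : p \is d.-homog ->
  p = \sum_(i < d.+1) p@_(bimon d i) *: 'X_[bimon d i].
Proof.
move=> hp; apply/mpolyP => x; rewrite raddf_sum /=.
have [xd|xd] := eqVneq (mdeg x) d; last first.
  rewrite (dhomog_nemf_coeff hp) // big1 // => i _.
  rewrite mcoeffZ mcoeffX; case: eqP => [e|]; last by rewrite mulr0.
  by rewrite -e mdeg_bimon ?eqxx // -ltnS in xd.
have ltx : (x ord0 < d.+1)%N by rewrite ltnS -xd mdegE big_ord_recl leq_addr.
have xb : bimon d (x ord0) = x by rewrite [RHS]bimonE xd.
rewrite (bigD1 (Ordinal ltx)) //= xb mcoeffZ mcoeffX eqxx mulr1 big1 ?addr0 //.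
move=> i ni; rewrite mcoeffZ mcoeffX; case: eqP => [e|]; last by rewrite mulr0.
by case/eqP: ni; apply: val_inj; rewrite /= -e bimon_fst.
Qed.

Variables (g : nat) (G : 'rV[k]_g).
Hypothesis g_gt0 : (0 < g)%N.

(** Components of degree other than [g - 1] are ignored, so the cofactor in [in_span] may be
    inhomogeneous. *)
Definition pairing (p : {mpoly k[2]}) : k :=
  \sum_(l < g) p@_(bimon g.-1 l) * G 0 l.

Lemma pairing_sum (I : Type) (s : seq I) (a : I -> k) (p : I -> {mpoly k[2]}) :
  pairing (\sum_(i <- s) a i *: p i) = \sum_(i <- s) a i * pairing (p i).
Proof.
rewrite /pairing; under [RHS]eq_bigr => i _ do rewrite mulr_sumr.
rewrite exchange_big; apply: eq_bigr => l _.
rewrite raddf_sum mulr_suml; apply: eq_bigr => i _ /=.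
by rewrite mcoeffZ mulrA.
Qed.

Lemma pairing_monomial (x : 'X_{1..2}) :
  pairing 'X_[x] = if mdeg x == g.-1 then coords G (x ord0) else 0.
Proof.
case: eqP => [xd|xd]; last first.
  rewrite /pairing big1 // => l _; rewrite mcoeffX; case: eqP => [e|]; last by rewrite mul0r.
  by case: xd; rewrite e mdeg_bimon // -ltnS prednK.
have ltx : (x ord0 < g)%N by rewrite -(prednK g_gt0) ltnS -xd mdegE big_ord_recl leq_addr.
have xb : bimon g.-1 (x ord0) = x by rewrite [RHS]bimonE xd.
rewrite /pairing (bigD1 (Ordinal ltx)) //= xb mcoeffX eqxx mul1r big1.
  by rewrite addr0 /coords insubT.
move=> l nl; rewrite mcoeffX; case: eqP => [e|]; last by rewrite mul0r.
by case/eqP: nl; apply: val_inj; rewrite /= e bimon_fst.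
Qed.

Definition dehom m (f : {mpoly k[2]}) : {poly k} := \poly_(i < m.+1) f@_(bimon m i).

Lemma pairing_apolar m (f : {mpoly k[2]}) : (m < g)%N -> f \is m.-homog ->
  [<-> forall x, (m + mdeg x)%N = g.-1 -> pairing (f * 'X_[x]) = 0;
     apolar g (coords G) m (dehom m f);
     forall q, pairing (f * q) = 0].
Proof.
move=> ltm hf.
have pE (x : 'X_{1..2}) : pairing (f * 'X_[x]) =
  if (m + mdeg x == g.-1)%N
  then \sum_(i < m.+1) f@_(bimon m i) * coords G (i + x ord0) else 0.
  rewrite {1}(binary_formE hf) mulr_suml.
  under eq_bigr => i _ do rewrite -scalerAl -mpolyXD.
  rewrite pairing_sum; case: ifP => [e|ne].
    apply: eq_bigr => i _.
    by rewrite pairing_monomial mdegD mdeg_bimon_ord e mnmDE bimon_fst.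
  rewrite big1 // => i _.
  by rewrite pairing_monomial mdegD mdeg_bimon_ord ne mulr0.
have dE j : \sum_(i < m.+1) (dehom m f)`_i * coords G (i + j) =
    \sum_(i < m.+1) f@_(bimon m i) * coords G (i + j).
  by apply: eq_bigr => i _; rewrite coef_poly ltn_ord.
tfae=> [H|[_ H] q|//].
  split=> [|j jm]; first exact: size_poly.
  have := H (bimon (g.-1 - m) j); rewrite pE mdeg_bimon; last by lia.
  by rewrite subnKC ?eqxx ?bimon_fst ?dE => [->|] //; lia.
rewrite (mpolyE q) mulr_sumr; under eq_bigr => x _ do rewrite -scalerAr.
rewrite pairing_sum big1 // => x _; rewrite pE; case: eqP => [e|]; last by rewrite mulr0.
rewrite -dE H ?mulr0 //.
have : (x ord0 <= mdeg x)%N by rewrite mdegE big_ord_recl leq_addr.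
lia.
Qed.

End BinaryForms.

(** * Secant varieties *)

Section ConeIso.
Variable k : fieldType.

Lemma alg_iso_linear q (X Y : 'rV[k]_q -> Prop) (M : 'M[k]_q) : M \in unitmx ->
  (forall x, X x <-> Y (x *m M)) -> alg_iso X Y.
Proof.
pose lin (N : 'M[k]_q) (j : 'I_q) : {mpoly k[q]} := \sum_i N i j *: 'X_i.
have linE N v : polymap (lin N) v = v *m N.
  apply/rowP => j; rewrite !mxE /peval /lin raddf_sum /=; apply: eq_bigr => i _.
  by rewrite mevalZ mevalXU mulrC.
move=> uM XY; exists (lin M), (lin (invmx M)); split=> [x Xx|y Yy].
  by rewrite !linE mulmxK //; split=> //; apply/XY.
by rewrite !linE mulmxKV //; split=> //; apply/XY; rewrite mulmxKV.
Qed.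

Lemma affine_cone_secant g (F : 'I_g -> {mpoly k[2]}) m v :
  affine_cone (secant_variety F m) v <->
  exists f : {mpoly k[2]}, [/\ f != 0, f \is m.-homog & in_span F f v].
Proof.
split=> [[->|[c [w [[_ [f [nz hf Hf]]] ->]]]]|Hf].
- exists 'X_[bimon m 0]; split; first by rewrite -msupp_eq0 msuppX.
    by rewrite dhomogX /= mdeg_bimon.
  by move=> h _; rewrite big1 // => i _; rewrite mxE mulr0.
- exists f; split=> // h /Hf e0; rewrite -[RHS](mulr0 c) -[X in _ = _ * X]e0 mulr_sumr.
  by apply: eq_bigr => i _; rewrite mxE mulrCA.
have [->|nz] := eqVneq v 0; first by left.
by right; exists 1, v; rewrite scale1r.
Qed.

(** The isomorphism is linear: it replaces the values of the functional on monomials by its values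
    on the basis [F], through the invertible coefficient matrix [A]. *)
Lemma cone_iso g m (F : 'I_g -> {mpoly k[2]}) : (m < g)%N -> rational_normal_curve F ->
  alg_iso (fun G : 'rV[k]_g => exists2 f, f != 0 & apolar g (coords G) m f)
          (affine_cone (secant_variety F m)).
Proof.
move=> ltm [hF FI]; have g0 : (0 < g)%N by lia.
have {}hF i : F i \is g.-1.-homog by rewrite -subn1.
have expand (p : {mpoly k[2]}) : p \is g.-1.-homog ->
    p = \sum_(l < g) p@_(bimon g.-1 l) *: 'X_[bimon g.-1 l].
  by move=> hp; have := binary_formE hp; rewrite prednK.
pose A : 'M_g := \matrix_(i, l) (F i)@_(bimon g.-1 l).
have combE (h : 'I_g -> k) : \sum_i h i *: F i =
    \sum_(l < g) ((\row_i h i) *m A) 0 l *: 'X_[bimon g.-1 l].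
  under eq_bigr => i _ do rewrite (expand _ (hF i)) scaler_sumr.
  rewrite exchange_big; apply: eq_bigr => l _; rewrite mxE scaler_suml.
  by apply: eq_bigr => i _; rewrite !mxE scalerA.
have uA : A \in unitmx.
  rewrite -row_free_unit -kermx_eq0; apply/rowV0P => c /sub_kermxP cA.
  apply/rowP => i; rewrite mxE; apply: (FI (fun i => c 0 i)).
  rewrite combE big1 // => l _.
  have -> : \row_i c 0 i = c by apply/rowP => j; rewrite mxE.
  by rewrite cA mxE scale0r.
apply: (alg_iso_linear (M := A^T)) => [|G]; first by rewrite unitmx_tr.
have spanE (f : {mpoly k[2]}) : f \is m.-homog ->
    in_span F f (G *m A^T) <-> apolar g (coords G) m (dehom m f).
  move=> hf.
  have dotE (h : 'I_g -> k) : \sum_(i < g) h i * (G *m A^T) 0 i =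
      pairing G (\sum_(i < g) h i *: F i).
    rewrite combE pairing_sum; under eq_bigr => i _ do rewrite mxE mulr_sumr.
    rewrite exchange_big; apply: eq_bigr => l _.
    rewrite pairing_monomial // mdeg_bimon ?eqxx ?bimon_fst ?coords_ord; last first.
      by rewrite -ltnS prednK.
    rewrite mxE mulr_suml; apply: eq_bigr => i _.
    by rewrite [A^T _ _]mxE [(\row_ _ _) _ _]mxE; ring.
  have tfae := pairing_apolar G g0 ltm hf.
  split=> [H|/(tfae 1%N 2%N) H h [q e]]; last by rewrite dotE e.
  apply/(tfae 0%N 1%N) => x dx.
  (* As [F] is a basis, [f * 'X_[x]] is a combination of the [F i]; its coefficients [c *m invmx A]
     define a hyperplane containing the zero scheme of [f]. *)
  pose c : 'rV_g := \row_l (f * 'X_[x])@_(bimon g.-1 l).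
  have := H (fun i => (c *m invmx A) 0 i); rewrite dotE combE.
  have -> : \row_i (c *m invmx A) 0 i = c *m invmx A by apply/rowP => j; rewrite mxE.
  rewrite mulmxKV //; under eq_bigr => l _ do rewrite mxE.
  rewrite -expand => [->//|]; first by exists 'X_[x].
  by rewrite -dx; apply: dhomogM => //; rewrite dhomogX.
rewrite affine_cone_secant; split=> [[f nz Kf]|[f [nz hf /(spanE _ hf) Kf]]].
  pose F' : {mpoly k[2]} := \sum_(i < m.+1) f`_i *: 'X_[bimon m i].
  have hF' : F' \is m.-homog.
    by apply: rpred_sum => i _; rewrite rpredZ // dhomogX /= mdeg_bimon // -ltnS.
  have dF : dehom m F' = f.
    apply/polyP => i; rewrite coef_poly; case: ltnP => [ltim|lemi]; last first.
      by rewrite nth_default // (leq_trans Kf.1).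
    rewrite raddf_sum (bigD1 (Ordinal ltim)) //= mcoeffZ mcoeffX eqxx mulr1.
    rewrite big1 ?addr0 // => j nj; rewrite mcoeffZ mcoeffX.
    case: eqP => [/bimon_inj e|]; last by rewrite mulr0.
    by case/eqP: nj; apply: val_inj.
  exists F'; split=> //; last by apply/spanE; rewrite ?dF.
  apply: contraNneq nz => F0; rewrite -dF F0; apply/eqP/polyP => i.
  by rewrite coef_poly mcoeff0 coef0 if_same.
exists (dehom m f) => //; apply: contraNneq nz => d0.
rewrite (binary_formE hf) big1 // => i _.
have := congr1 (fun p : {poly k} => p`_i) d0; rewrite coef_poly ltn_ord coef0 => ->.
by rewrite scale0r.
Qed.

End ConeIso.

(** * Upper bound for the dimension *)

Section BoxMonomials.
Variable N : nat.

(* The exponents of the monomials in [e] variables of degree less than [N] in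
   each of them. *)
Fixpoint box e : finType := if e is e'.+1 then (box e' * 'I_N)%type else unit.

Fixpoint box_mon (R : pzSemiRingType) (u : nat -> R) e : box e -> R :=
  if e is e'.+1 then fun a => box_mon u a.1 * u e' ^+ a.2 else fun=> 1.

Lemma card_box e : #|box e| = (N ^ e)%N.
Proof.
by elim: e => [|e IHe] /=; rewrite ?card_unit // card_prod IHe card_ord expnSr.
Qed.

Lemma rmorph_box_mon (R S : pzSemiRingType) (f : {rmorphism R -> S}) u e (a : box e) :
  f (box_mon u a) = box_mon (f \o u) a.
Proof.
elim: e a => [|e IHe] /= a; first exact: rmorph1.
by rewrite rmorphM rmorphXn IHe.
Qed.

Lemma eq_box_mon (R : pzSemiRingType) (u v : nat -> R) e (a : box e) :
  u =1 v -> box_mon u a = box_mon v a.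
Proof. by move=> uv; elim: e a => //= e IHe a; rewrite IHe uv. Qed.

End BoxMonomials.

Section Dimension.
Variable k : fieldType.

Lemma zariski_closed_zero q (p : {mpoly k[q]}) : zariski_closed (fun v => peval p v = 0).
Proof. by exists (eq p) => v; split=> [p0 _ <-|]; last apply. Qed.

(* If [u i] vanishes on [Z i] but not on [Z i.+1], then the [u i] are
   algebraically independent on the top of the chain: divide a relation by a
   power of the last [u i], which is possible by irreducibility, and restrict
   it one step down, where that [u i] vanishes. *)
Lemma chain_box_mon_free q W e (Z : nat -> 'rV[k]_q -> Prop) N
    (u : nat -> {mpoly k[q]}) :
  irreducible_chain W e Z ->
  (forall i, (i < e)%N -> (forall v, Z i v -> peval (u i) v = 0) /\
                          exists2 v, Z i.+1 v & peval (u i) v != 0) ->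
  forall j, (j <= e)%N -> forall c : box N j -> k,
  (forall v, Z j v -> \sum_a c a * box_mon (fun i => peval (u i) v) a = 0) ->
  forall a, c a = 0.
Proof.
move=> [Zirr Zlt] uZ; elim=> [|j IHj] lej c H.
  have [_ [[v Zv] _] _] := Zirr 0 lej => -[].
  by have := H v Zv; rewrite (bigD1 (tt : box N 0)) //= big1 ?addr0 ?mulr1 // => -[].
suff main b (ltb : (b < N)%N) : forall a : box N j, c (a, Ordinal ltb) = 0.
  by move=> [a [b ltb]]; apply: main.
elim/ltn_ind: b ltb => b IHb ltb.
have [u0 [w Zw uw]] := uZ j lej.
(* [S] is the relation divided by [u j ^+ b]; the terms of smaller exponent in [u j] vanish by
   induction on [b]. *)
pose S : {mpoly k[q]} := \sum_(x : box N j.+1 | (b <= x.2)%N)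
  c x *: (box_mon u x.1 * u j ^+ (x.2 - b)).
have SE v : peval S v = \sum_(x : box N j.+1 | (b <= x.2)%N)
    c x * (box_mon (fun i => peval (u i) v) x.1 * peval (u j) v ^+ (x.2 - b)).
  rewrite /peval /S raddf_sum; apply: eq_bigr => x _.
  by rewrite /= mevalZ mevalM rmorphXn /= rmorph_box_mon.
have [_ [_ irr] _] := Zirr _ lej.
have [ZA|ZB] : subset_of (Z j.+1) (fun v => peval (u j) v = 0) \/
    subset_of (Z j.+1) (fun v => peval S v = 0).
- apply: irr; [exact: zariski_closed_zero|exact: zariski_closed_zero|].
  move=> v Zv; have := H v Zv.
  rewrite (bigID (fun x : box N j.+1 => (b <= x.2)%N)) /= [X in _ + X]big1; last first.
    move=> [a [b' ltb']] /=; rewrite -ltnNge => ltbb.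
    by rewrite IHb // mul0r.
  rewrite addr0 => H0.
  have : peval (u j) v ^+ b * peval S v = 0.
    rewrite SE mulr_sumr -[RHS]H0; apply: eq_bigr => x bx.
    by rewrite -[X in _ = _ * (_ * _ ^+ X)](subnK bx) exprD; ring.
  by move=> /eqP; rewrite mulf_eq0 expf_eq0 => /orP[/andP[_ /eqP]|/eqP]; [left|right].
- by case/eqP: uw; apply: ZA.
apply: (IHj (ltnW lej) (fun a : box N j => c (a, Ordinal ltb))) => v Zv.
have := ZB v (proj1 (Zlt _ lej) v Zv); rewrite SE => S0; rewrite -[RHS]S0.
rewrite [RHS]big_mkcond (eq_bigr (fun x : box N j.+1 =>
  (fun (a : box N j) (b' : 'I_N) => if (b <= b')%N then
    c (a, b') * (box_mon (fun i => peval (u i) v) a * peval (u j) v ^+ (b' - b)) else 0)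
    x.1 x.2)); last by case.
rewrite -(pair_bigA _ (fun (a : box N j) (b' : 'I_N) => if (b <= b')%N then
    c (a, b') * (box_mon (fun i => peval (u i) v) a * peval (u j) v ^+ (b' - b)) else 0)) /=.
apply: eq_bigr => a _; rewrite (bigD1 (Ordinal ltb)) //= leqnn subnn mulr1.
rewrite big1 ?addr0 // => b' nb; case: leqP => // leb.
have ltbb : (b < b')%N by rewrite ltn_neqAle leb andbT eq_sym.
by rewrite u0 // expr0n subn_eq0 leqNgt ltbb !mulr0.
Qed.

Lemma left_kernel (I J : finType) (A : I -> J -> k) : (#|J| < #|I|)%N ->
  exists c : I -> k, (exists i, c i != 0) /\ forall j, \sum_i c i * A i j = 0.
Proof.
move=> ltJI; pose M := \matrix_(i < #|I|, j < #|J|) A (enum_val i) (enum_val j).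
have : kermx M != 0.
  by rewrite kermx_eq0 /row_free neq_ltn (leq_ltn_trans (rank_leq_col M)).
case/rowV0Pn => c /sub_kermxP cM; case/rV0Pn => i nz.
exists (fun i => c 0 (enum_rank i)); split=> [|j].
  by exists (enum_val i); rewrite enum_valK.
have := congr1 (fun R : 'rV_#|J| => R 0 (enum_rank j)) cM; rewrite !mxE => e0.
rewrite -[RHS]e0 (reindex_onto enum_rank enum_val) /=; last by move=> x _; rewrite enum_valK.
by apply: eq_big => x; rewrite ?enum_rankK ?eqxx // => _; rewrite mxE !enum_rankK.
Qed.

Lemma card_bmultinom p M : (#|{: 'X_{1..p < M}}| <= M ^ p)%N.
Proof.
have lt (x : 'X_{1..p < M}) (i : 'I_p) : (bmnm x i < M)%N.
  case: x => x /= dx; apply: leq_ltn_trans dx.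
  by rewrite mdegE (bigD1 i) //= leq_addr.
pose f (x : 'X_{1..p < M}) := [ffun i => Ordinal (lt x i)].
have -> : (M ^ p)%N = #|{ffun 'I_p -> 'I_M}| by rewrite card_ffun !card_ord.
apply: (@leq_card _ _ f) => x y /ffunP e; apply/val_inj/mnmP => i.
by have := e i; rewrite !ffunE => /(congr1 val).
Qed.

Lemma msize_mul_le p (a b : {mpoly k[p]}) i j :
  (msize a <= i.+1)%N -> (msize b <= j.+1)%N -> (msize (a * b) <= (i + j).+1)%N.
Proof.
move=> ai bj; have [->|a0] := eqVneq a 0; first by rewrite mul0r msize0.
have [->|b0] := eqVneq b 0; first by rewrite mulr0 msize0.
by rewrite msizeM //; move: (leq_add ai bj); rewrite addSn addnS; case: (_ + _)%N.
Qed.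

Lemma msize_box_mon p N D (u : nat -> {mpoly k[p]}) e (a : box N e) :
  (forall i, (i < e)%N -> (msize (u i) <= D.+1)%N) ->
  (msize (box_mon u a) <= (e * (N * D)).+1)%N.
Proof.
elim: e a => [|e IHe] a uD; first by rewrite /= msize1.
rewrite mulSn addnC; apply: msize_mul_le; first by apply: IHe => i /ltnW; apply: uD.
case: a => a [b /= /ltnW leb].
suff H n : (msize (u e ^+ n) <= (n * D).+1)%N.
  by apply: leq_trans (H b) _; rewrite ltnS leq_mul2r leb orbT.
elim: n => [|n IHn]; first by rewrite expr0 msize1.
by rewrite exprS mulSn; apply: msize_mul_le => //; apply: uD.
Qed.

(* Counting: the number of monomials of the [u i] in the box grows like
   [N ^ e], that of monomials in [p] variables of the same degree like
   [N ^ p]. *)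
Lemma box_mon_dependent p e S (U : 'I_S -> nat -> {mpoly k[p]}) : (p < e)%N ->
  exists N, exists c : box N e -> k, (exists a, c a != 0) /\
    forall s, \sum_a c a *: box_mon (U s) a = 0.
Proof.
move=> ltpe; pose D := (\max_(s < S) \max_(i < e) msize (U s i))%N.
have UD s i : (i < e)%N -> (msize (U s i) <= D.+1)%N.
  move=> lti; apply: leqW; rewrite /D.
  rewrite (leq_trans _ (leq_bigmax s)) //.
  exact: (leq_bigmax (F := fun i : 'I_e => msize (U s i)) (Ordinal lti)).
(* There are [N ^ e] unknowns and at most [S * M ^ p] equations, with [M <= (e * D).+1 * N]. This
   choice bounds the equations by [(N - 1) * N ^ p < N ^ p.+1 <= N ^ e]. *)
pose N := (S * (e * D).+1 ^ p).+1; exists N.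
pose M := (e * (N * D)).+1.
have [|c [cn0 cA]] := @left_kernel (box N e) ('I_S * 'X_{1..p < M})%type
    (fun a x => (box_mon (U x.1) a)@_(bmnm x.2)).
  rewrite card_box card_prod card_ord.
  apply: leq_ltn_trans (_ : _ <= S * M ^ p)%N _.
    by rewrite leq_mul2l card_bmultinom orbT.
  have leM : (M <= (e * D).+1 * N)%N by rewrite /M; nia.
  apply: leq_ltn_trans (_ : _ <= S * ((e * D).+1 * N) ^ p)%N _.
    rewrite leq_mul2l; apply/orP; right.
    by case: (posnP p) => [->|p0]; rewrite ?expn0 // leq_exp2r.
  have eE : e = (p + (e - p.+1)).+1 by lia.
  rewrite expnMn mulnA [X in (_ < _ ^ X)%N]eE.
  rewrite expnS; apply: leq_trans (_ : N * N ^ p <= _)%N.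
    by rewrite ltn_mul2r expn_gt0 /=.
  by rewrite leq_mul2l leq_pexp2l ?leq_addr // orbT.
exists c; split=> // s; apply/mpolyP => x; rewrite mcoeff0 raddf_sum /=.
have [ltx|lex] := ltnP (mdeg x) M.
  rewrite -[RHS](cA (s, BMultinom ltx)); apply: eq_bigr => a _; exact: mcoeffZ.
rewrite big1 // => a _; rewrite mcoeffZ [X in _ * X]memN_msupp_eq0 ?mulr0 //.
apply: msize_mdeg_ge; apply: leq_trans lex; apply: msize_box_mon => i; exact: UD.
Qed.

(** The top of the chain may meet several images, so one relation is chosen that holds after
    pullback to every chart at once. *)
Lemma irreducible_chain_le q p S (W : 'rV[k]_q -> Prop) (phi : 'I_S -> 'I_q -> {mpoly k[p]}) :
  (forall v, W v -> exists s x, v = polymap (phi s) x) ->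
  forall e Z, irreducible_chain W e Z -> (e <= p)%N.
Proof.
move=> cover e Z chainZ; rewrite leqNgt; apply/negP => ltpe.
have exu (i : 'I_e) : exists u : {mpoly k[q]},
    (forall v, Z i v -> peval u v = 0) /\ exists2 v, Z i.+1 v & peval u v != 0.
  have [[I HI] _ _] := chainZ.1 i (ltnW (ltn_ord i)).
  have [_ nsub] := chainZ.2 i (ltn_ord i).
  apply: NNPP => noU; apply: nsub => v Zv; apply/HI => f If.
  apply: NNPP => fv; apply: noU; exists f; split=> [w /HI|]; first exact.
  by exists v => //; apply/eqP.
have [u Hu] := finite_choice exu.
pose u' i := if insub i is Some j then u j else 0.
have Hu' i : (i < e)%N -> (forall v, Z i v -> peval (u' i) v = 0) /\
    exists2 v, Z i.+1 v & peval (u' i) v != 0.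
  by move=> lti; rewrite /u' insubT; apply: (Hu (Ordinal lti)).
pose U s i := u' i \mPo [tuple phi s j | j < q].
have UE s i x : peval (U s i) x = peval (u' i) (polymap (phi s) x).
  rewrite /peval comp_mpoly_meval; apply: meval_eq => j.
  by rewrite tnth_mktuple mxE.
have [N [c [[a nz] Hc]]] := box_mon_dependent U ltpe.
case/eqP: nz; apply: (chain_box_mon_free chainZ Hu' (leqnn e)) => v Zv.
have [_ _ ZW] := chainZ.1 e (leqnn e).
have [s [x ->]] := cover v (ZW v Zv).
have := congr1 (fun f : {mpoly k[p]} => peval f x) (Hc s).
rewrite /peval meval0 raddf_sum /= => e0; rewrite -[RHS]e0; apply: eq_bigr => b _.
rewrite mevalZ rmorph_box_mon; congr (_ * _); apply: eq_box_mon => i /=.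
by rewrite -/(peval _ _) -UE.
Qed.

End Dimension.

(** * Parametrization by linear recurrences *)

Section Recurrence.
Variables (l d : nat).

Section Ring.
Variables (R : comPzRingType) (y f : nat -> R).

Definition recur_next (s : seq R) (i : nat) : R :=
  if (i < l)%N then y i
  else if (i < l + d)%N then - \sum_(a < l) f a * s`_(i - l + a)
  else y (i - d)%N.

Fixpoint recur_seq n : seq R :=
  if n is n'.+1 then rcons (recur_seq n') (recur_next (recur_seq n') n') else [::].

(* The sequence with initial terms [y 0], ..., [y (l - 1)] which satisfies [d]
   times the linear recurrence with characteristic polynomial
   ['X^l + \sum_(a < l) f a *: 'X^a] and then continues with [y l], ... *)
Definition recur i : R := recur_next (recur_seq i) i.

Lemma nth_recur_seq n i : (i < n)%N -> (recur_seq n)`_i = recur i.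
Proof.
have sz m : size (recur_seq m) = m by elim: m => //= m IHm; rewrite size_rcons IHm.
elim: n => // n IHn; rewrite ltnS leq_eqVlt /= nth_rcons sz => /orP[/eqP->|lti].
  by rewrite ltnn eqxx.
by rewrite lti IHn.
Qed.

Lemma recurE i : recur i =
  if (i < l)%N then y i
  else if (i < l + d)%N then - \sum_(a < l) f a * recur (i - l + a)
  else y (i - d)%N.
Proof.
rewrite {1}/recur /recur_next; case: ltnP => // leli; case: ltnP => // _.
congr (- _); apply: eq_bigr => a _; rewrite nth_recur_seq //.
by have := ltn_ord a; lia.
Qed.

(** The bound [g] lets this apply to the coordinates of a point, which satisfy the recurrence only
    up to that index. *)
Lemma recur_uniq g (v : nat -> R) :
  (forall i, (i < g)%N -> v i =
    if (i < l)%N then y i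
    else if (i < l + d)%N then - \sum_(a < l) f a * v (i - l + a)%N
    else y (i - d)%N) ->
  forall i, (i < g)%N -> v i = recur i.
Proof.
move=> Hv; elim/ltn_ind => i IHi lti; rewrite recurE Hv //.
case: ltnP => // leli; case: ltnP => // _; congr (- _); apply: eq_bigr => a _.
by rewrite IHi //; have := ltn_ord a; lia.
Qed.

End Ring.

Lemma rmorph_recur (R S : comPzRingType) (h : {rmorphism R -> S}) y f i :
  h (recur y f i) = recur (h \o y) (h \o f) i.
Proof.
apply: (@recur_uniq _ _ _ i.+1 (fun j => h (recur y f j))) => // {}i _; rewrite recurE.
case: ltnP => // leli; case: ltnP => // _; rewrite rmorphN rmorph_sum.
by congr (- _); apply: eq_bigr => a _; rewrite rmorphM.
Qed.

Lemma eq_recur (R : comPzRingType) (y y' f f' : nat -> R) i :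
  y =1 y' -> f =1 f' -> recur y f i = recur y' f' i.
Proof.
move=> yy ff; apply: (@recur_uniq _ _ _ i.+1 (recur y f)) => // {}i _.
rewrite recurE !yy; case: ifP => // _; case: ifP => // _.
by congr (- _); apply: eq_bigr => a _; rewrite ff.
Qed.

End Recurrence.

Section Cover.
Variables (k : fieldType) (g m : nat).
Hypothesis lt2mg : (2 * m < g)%N.

(* The coordinates [t i] with [i < m] are initial terms, and [t (2 * m - 1 - a)]
   is the coefficient [f a] of the recurrence. *)
Definition recur_point (R : comPzRingType) l (t : nat -> R) : nat -> R :=
  recur l (g - m) t (fun a => t (2 * m - 1 - a)%N).

Definition recur_poly l (j : 'I_g) : {mpoly k[2 * m]} :=
  recur_point l (@mcoord k (2 * m)) j.

Lemma polymap_recur_poly l x : polymap (recur_poly l) x = \row_j recur_point l (coords x) j.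
Proof.
apply/rowP => j; rewrite !mxE /recur_poly /recur_point /peval rmorph_recur.
by apply: eq_recur => i; rewrite /= -/(peval _ _) peval_mcoord.
Qed.

Lemma apolar_cover v : (exists2 f, f != 0 & apolar g (coords v) m f) ->
  exists l : 'I_m.+1, exists x, v = polymap (recur_poly l) x.
Proof.
move=> [f nz [sf Hf]].
have sl : ((size f).-1 < m.+1)%N by case: (size f) sf.
have sE : size f = (size f).-1.+1 by rewrite prednK // size_poly_gt0.
set l := (size f).-1 in sl sE *; exists (Ordinal sl) => /=.
have lcn : f`_l != 0 by rewrite -lead_coefE lead_coef_eq0.
(* With [l] the degree of [f], apolarity determines the [g - m] terms from index [l] on. Free are
   the first [l] terms, the last [m - l] terms, and the [l] normalized coefficients of [f], stored
   from the end of [t]. *)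
pose t i := if (i < l)%N then coords v i
  else if (i < m)%N then coords v (i + (g - m)) else f`_(2 * m - 1 - i) / f`_l.
exists (\row_i t i); rewrite polymap_recur_poly; apply/rowP => j; rewrite mxE -coords_ord.
apply: (recur_uniq (g := g)) => // i lti.
have tE e : (e < 2 * m)%N -> coords (\row_(i < 2 * m) t i) e = t e.
  by move=> lte; rewrite /coords insubT mxE.
case: ltnP => [ltil|leli]; first by rewrite tE /t ?ltil //; lia.
case: ltnP => [ltid|ledi]; last first.
  rewrite tE; last by lia.
  rewrite /t ifF; last by lia.
  rewrite ifT; last by lia.
  by congr coords; lia.
have := Hf (i - l)%N; have -> : m.+1 = (l + (m - l).+1)%N by lia.
rewrite big_split_ord big_ord_recl /= addn0 [X in _ + (_ + X)]big1 => [|a _]; last first.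
  by rewrite nth_default ?mul0r // sE /bump /=; lia.
rewrite addr0 subnKC // => /(_ _)/eqP; rewrite addr_eq0 => Ei.
have {}Ei := eqP (Ei _); rewrite [LHS](_ : _ = (f`_l * coords v i) / f`_l); last first.
  by rewrite mulrC mulKf.
rewrite -[f`_l * _]opprK -Ei; last by lia.
rewrite mulNr mulr_suml; congr (- _); apply: eq_bigr => a _; have lta := ltn_ord a.
rewrite tE; last by lia.
rewrite /t ifF; last by lia.
rewrite ifF; last by lia.
have -> : (2 * m - 1 - (2 * m - 1 - a) = a)%N by lia.
by rewrite addnC mulrAC.
Qed.

Lemma apolar_recur_point (t : nat -> k) :
  exists2 f, f != 0 & apolar g (coords (\row_(j < g) recur_point m t j)) m f.
Proof.
exists ('X^m + \poly_(a < m) t (2 * m - 1 - a)%N).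
  apply/eqP => /(congr1 (fun p : {poly k} => p`_m)).
  rewrite coefD coefXn eqxx coef_poly ltnn addr0 coef0 => /eqP.
  by rewrite oner_eq0.
split.
  rewrite (leq_trans (size_polyD _ _)) // size_polyXn geq_max leqnn.
  exact/leqW/size_poly.
have cE i : (i < g)%N -> coords (\row_(j < g) recur_point m t j) i = recur_point m t i.
  by move=> lti; rewrite /coords insubT mxE.
move=> j jm; rewrite big_ord_recr /= coefD coefXn eqxx coef_poly ltnn addr0 mul1r.
rewrite cE; last by rewrite addnC.
rewrite {2}/recur_point recurE ifF; last by lia.
rewrite ifT; last by lia.
apply/eqP; rewrite subr_eq0; apply/eqP/eq_bigr => a _; have lta := ltn_ord a.
rewrite coefD coefXn coef_poly lta ltn_eqF // add0r cE; last by lia.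
by rewrite addKn addnC.
Qed.

End Cover.

(** * Lower bound for the dimension *)

Section Closure.
Variables (k : fieldType) (q : nat).

Definition zariski_closure (S : 'rV[k]_q -> Prop) (v : 'rV[k]_q) : Prop :=
  forall p, (forall w, S w -> peval p w = 0) -> peval p v = 0.

Lemma zariski_closure_closed S : zariski_closed (zariski_closure S).
Proof. by exists (fun p => forall w, S w -> peval p w = 0). Qed.

Lemma zariski_closure_min S W : zariski_closed W -> subset_of S W ->
  subset_of (zariski_closure S) W.
Proof. by move=> [I HI] SW v Sv; apply/HI => p Ip; apply: Sv => w /SW/HI; apply. Qed.

Lemma meval_horner n (p : {mpoly k[n]}) (w : 'I_n -> {poly k}) :
  exists P : {poly k}, forall s, P.[s] = p.@[fun i => (w i).[s]].
Proof.
exists (\sum_(m <- msupp p) (p@_m)%:P * \prod_i w i ^+ m i) => s.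
rewrite mevalE horner_sum; apply: eq_bigr => m _.
rewrite hornerM hornerC horner_prod; congr (_ * _).
by apply: eq_bigr => i _; rewrite horner_exp.
Qed.

Lemma poly_fun_eq0 (P : {poly k}) : [pchar k] =i pred0 -> (forall s, P.[s] = 0) -> P = 0.
Proof.
move=> char0 P0; apply/eqP/negP => /negP nz.
(* In characteristic 0 these are [size P] distinct roots, one more than the degree. *)
have := max_poly_roots nz (rs := [seq i%:R | i <- iota 0 (size P)]).
rewrite size_map size_iota ltnn => /(_ _ _)/negP; apply => //.
  by apply/allP => x _; rewrite /root P0.
rewrite map_inj_in_uniq ?iota_uniq // => i j _ _ /eqP; wlog leij : i j / (i <= j)%N.
  by move=> H; case/orP: (leq_total i j) => [/H//|/H{}H]; rewrite eq_sym => /H.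
rewrite eq_sym -subr_eq0 -natrB // (proj1 (pcharf0P k) char0) => /eqP ji0.
by apply/eqP; rewrite eqn_leq leij -subn_eq0 ji0.
Qed.

(* Polynomials pulled back to a curve through two points lie in the domain
   [{poly k}]. *)
Lemma irreducible_closure (S : 'rV[k]_q -> Prop) : [pchar k] =i pred0 ->
  (exists v, S v) ->
  (forall v w, S v -> S w -> exists c : 'I_q -> {poly k},
     [/\ \row_i (c i).[0] = v, \row_i (c i).[1] = w &
         forall s, S (\row_i (c i).[s])]) ->
  irreducible_set (zariski_closure S).
Proof.
move=> char0 [v0 Sv0] curve.
have sub v : S v -> zariski_closure S v by move=> Sv p; apply.
split=> [|A B [IA HA] [IB HB] ZAB]; first by exists v0; apply: sub.
apply: NNPP => /not_or_and[nA nB].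
have notin (Y : 'rV[k]_q -> Prop) I : (forall v, Y v <-> (forall p, I p -> peval p v = 0)) ->
    ~ subset_of (zariski_closure S) Y -> exists2 p, I p & exists2 v, S v & peval p v != 0.
  move=> HY nsub; apply: NNPP => no; apply: nsub => v Zv; apply/HY => p Ip.
  apply: Zv => w Sw; apply: NNPP => /eqP pw; apply: no; exists p => //.
  by exists w.
have [pA IpA [v Sv pAv]] := notin _ _ HA nA.
have [pB IpB [w Sw pBw]] := notin _ _ HB nB.
have [c [c0 c1 Sc]] := curve v w Sv Sw.
have [PA PAE] := meval_horner pA c; have [PB PBE] := meval_horner pB c.
have pE p s : p.@[fun i => (c i).[s]] = peval p (\row_i (c i).[s]).
  by apply: meval_eq => i; rewrite mxE.
have /eqP : PA * PB = 0.
  apply: poly_fun_eq0 => // s; rewrite hornerM PAE PBE !pE.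
  have [/HA|/HB] := ZAB _ (sub _ (Sc s)).
    by move/(_ _ IpA) => ->; rewrite mul0r.
  by move/(_ _ IpB) => ->; rewrite mulr0.
rewrite mulf_eq0 => /orP[] /eqP P0.
  by case/eqP: pAv; rewrite -c0 -pE -PAE P0 horner0.
by case/eqP: pBw; rewrite -c1 -pE -PBE P0 horner0.
Qed.

End Closure.

Section LowerBound.
Variables (k : fieldType) (g m : nat).
Hypothesis char0 : [pchar k] =i pred0.
Hypothesis lt2mg : (2 * m < g)%N.

Definition flag_image j (v : 'rV[k]_g) : Prop :=
  exists2 t : nat -> k, (forall i, (j <= i)%N -> t i = 0) &
    v = \row_i recur_point g m m t i.

Lemma irreducible_flag_image j : irreducible_set (zariski_closure (flag_image j)).
Proof.
apply: irreducible_closure => //.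
  by exists (\row_i recur_point g m m (fun=> 0) i), (fun=> 0).
move=> _ _ [t t0 ->] [t' t'0 ->].
(* The curve is the image of the segment from [t] to [t'], obtained by running the recurrence over
   [{poly k}]. *)
pose T i : {poly k} := (t i)%:P + (t' i - t i) *: 'X.
have TE s i : (recur_point g m m T i).[s] =
    recur_point g m m (fun i => t i + (t' i - t i) * s) i.
  rewrite /recur_point -[_.[s]]/(horner_eval s _) rmorph_recur.
  by apply: eq_recur => a; rewrite /= /horner_eval /T !hornerE.
exists (fun i => recur_point g m m T i); split.
- apply/rowP => i; rewrite !mxE TE; apply: eq_recur => a; by rewrite mulr0 addr0.
- apply/rowP => i; rewrite !mxE TE; apply: eq_recur => a; by rewrite mulr1 addrC subrK.
move=> s; exists (fun i => t i + (t' i - t i) * s) => [i ji|].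
  by rewrite t0 // t'0 // subrr mul0r addr0.
by apply/rowP => i; rewrite !mxE TE.
Qed.

Lemma coords_recur_point (t : nat -> k) i : (i < g)%N ->
  coords (\row_(j < g) recur_point g m m t j) i = recur_point g m m t i.
Proof. by move=> lti; rewrite /coords insubT mxE. Qed.

(* For [j < m] the next coordinate vanishes on the image of the flag; from
   [j = m + j'] on, its terms of index at least [m - j'] satisfy a recurrence of
   order [j'], which fails for a sequence of ones in every [j' + 1]-st place. *)
Lemma flag_image_strict j : (j < 2 * m)%N -> exists C : 'rV[k]_g -> Prop,
  [/\ zariski_closed C, subset_of (flag_image j) C &
      exists2 v, flag_image j.+1 v & ~ C v].
Proof.
move=> lt2m; have [ltjm|lemj] := ltnP j m.
  exists (fun v => peval (mcoord k g j) v = 0); split.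
  - exact: zariski_closed_zero.
  - move=> v [t t0 ->]; rewrite peval_mcoord coords_recur_point; last by lia.
    by rewrite /recur_point recurE ltjm t0.
  exists (\row_i recur_point g m m (fun i => (i == j)%:R) i).
    by exists (fun i => (i == j)%:R) => // i ltji; rewrite gtn_eqF.
  rewrite peval_mcoord coords_recur_point; last by lia.
  by rewrite /recur_point recurE ltjm eqxx => /eqP; rewrite oner_eq0.
have [d dE] : exists d, j = (m + d)%N by exists (j - m)%N; lia.
rewrite {j lemj}dE in lt2m *; have ltdm : (d < m)%N by lia.
exists (hankel_singular d.+1 d.+1 (m - d)); split.
- exact: zariski_closed_hankel.
- move=> v [t t0 ->].
  (* The recurrence coefficients of index below [m - d] vanish here, so the characteristic
     polynomial is ['X^(m - d)] times a monic one of degree [d], whose coefficients form this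
     vector. *)
  exists (\row_(i < d.+1) if (i < d)%N then t (m + (d - i.+1))%N else 1).
    apply/eqP => /(congr1 (fun w : 'rV_d.+1 => w 0 ord_max)).
    by rewrite !mxE /= ltnn => /eqP; rewrite oner_eq0.
  move=> j ltj; rewrite big_ord_recr /= mxE ltnn mul1r coords_recur_point; last by lia.
  have -> : (m - d + d + j = m + j)%N by lia.
  rewrite {2}/recur_point recurE ifF; last by lia.
  rewrite ifT; last by lia.
  apply/eqP; rewrite subr_eq0; apply/eqP.
  pose F a := t (2 * m - 1 - a)%N * recur_point g m m t (j + a).
  transitivity (\sum_(a < m) F a); last first.
    by apply: eq_bigr => a _; congr (_ * recur_point _ _ _ _ _); lia.
  rewrite -[RHS](big_mkord xpredT F) (big_cat_nat (n := (m - d)%N)) //=; last by lia.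
  rewrite [X in _ = X + _](_ : _ = 0); last first.
    by rewrite big_nat big1 // => i /andP[_ lti]; rewrite /F t0 ?mul0r //; lia.
  have -> : \sum_(m - d <= i < m) F i = \sum_(i < d) F (i + (m - d))%N.
    rewrite -{1}[(m - d)%N]add0n big_addn (_ : (m - (m - d) = d)%N); last by lia.
    by rewrite big_mkord.
  rewrite add0r; apply: eq_bigr => i _; have lti := ltn_ord i.
  rewrite mxE /= lti coords_recur_point; last by lia.
  by rewrite /F; congr (t _ * recur_point _ _ _ _ _); lia.
pose per i : k := (i == m %[mod d.+1])%:R.
(* The only nonzero recurrence coefficient is -1, at index [m - d.+1], which makes the sequence
   periodic of period [d.+1]. *)
pose t i : k := if (i < m)%N then per i else if i == (m + d)%N then -1 else 0.
have perE i : (i < g)%N -> recur_point g m m t i = per i.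
  move=> lti; apply/esym; apply: (recur_uniq (g := g)) => // {lti}i lti.
  case: ltnP => [ltim|leim]; first by rewrite /t ltim.
  rewrite ifT; last by lia.
  have lta : (m - d.+1 < m)%N by lia.
  rewrite (bigD1 (Ordinal lta)) //= big1 ?addr0 => [|a na].
    have -> : (2 * m - 1 - (m - d.+1) = m + d)%N by lia.
    rewrite /t ltnNge leq_addr /= eqxx mulN1r opprK /per; congr (_ %:R).
    have -> : (i - m + (m - d.+1) = i - d.+1)%N by lia.
    by rewrite -[in LHS](subnK (_ : d.+1 <= i)%N) ?modnDr //; lia.
  have {}na : a <> (m - d.+1)%N :> nat by move=> e; case/eqP: na; apply: val_inj.
  have := ltn_ord a => lta'; rewrite /t ifF; last by lia.
  by rewrite ifF ?mul0r //; lia.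
exists (\row_i recur_point g m m t i).
  by exists t => // i lti; rewrite /t ifF ?ifF //; lia.
move=> [c nz Hc]; case/eqP: nz; apply/rowP => i; rewrite mxE; have lti := ltn_ord i.
(* The Hankel matrix of [per] has ones exactly on the antidiagonal, so column [d - i] isolates
   [c 0 i]. *)
have := Hc (d - i)%N; rewrite (bigD1 i) //= big1 ?addr0 => [|i' ni].
  rewrite coords_recur_point; last by lia.
  rewrite perE; last by lia.
  have -> : (m - d + i + (d - i) = m)%N by lia.
  by rewrite /per eqxx mulr1; apply; lia.
have lti' := ltn_ord i'; have {}ni : i' <> i :> nat by move=> e; case/eqP: ni; apply: val_inj.
rewrite coords_recur_point; last by lia.
rewrite perE; last by lia.
suff /negPf pF : m - d + i' + (d - i) != m %[mod d.+1] by rewrite /per pF mulr0.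
have shift x y : (0 < y < d.+1)%N -> x + y != x %[mod d.+1].
  move=> /andP[y0 ltyd]; rewrite -[X in _ != X %[mod _]]addn0 eqn_modDl mod0n.
  by rewrite modn_small // -lt0n.
have [lt|gt|e] := ltngtP i i'; last by case: ni.
  have -> : (m - d + i' + (d - i) = m + (i' - i))%N by lia.
  by apply: shift; lia.
have {2}-> : (m = m - d + i' + (d - i) + (i - i'))%N by lia.
by rewrite eq_sym; apply: shift; lia.
Qed.

(** Strictness survives taking closures because the sets separating consecutive images are
    closed. *)
Lemma irreducible_chain_hankel (W : 'rV[k]_g -> Prop) :
  zariski_closed W -> (forall t, W (\row_j recur_point g m m t j)) ->
  irreducible_chain W (2 * m) (fun j => zariski_closure (flag_image j)).
Proof.
move=> Wc Wt; have incl (S S' : 'rV[k]_g -> Prop) :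
    subset_of S S' -> subset_of S (zariski_closure S').
  by move=> SS v /SS Sv p; apply.
split=> j lej.
  split; [exact: zariski_closure_closed|exact: irreducible_flag_image|].
  by apply: zariski_closure_min => // v [t _ ->].
split.
  apply: zariski_closure_min; first exact: zariski_closure_closed.
  apply: incl => v [t t0 ->]; exists t => // i /ltnW; exact: t0.
have [C [Cc SC [v Sv nCv]]] := flag_image_strict lej.
move=> sub; apply: nCv; apply: (zariski_closure_min Cc SC).
by apply: sub; apply: incl Sv.
Qed.

End LowerBound.

Theorem theorem2p5 (k : closedFieldType) (char0 : [pchar k] =i pred0)
    (g n r : nat) (hrn : (r < n)%N) (hng : (2 * n <= g - 1)%N) :
  [/\ zariski_closed (@BN_locus k g n r),
      (forall F : 'I_g -> {mpoly k[2]}, rational_normal_curve F ->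
         alg_iso (@BN_locus k g n r)
                 (affine_cone (secant_variety F (n - r))))
    & has_dimension (@BN_locus k g n r) (2 * n - 2 * r)].
Proof.
have [m nE] : exists m, n = (m + r)%N by exists (n - r)%N; lia.
rewrite {n}nE addnK in hrn hng *; have lt2mg : (2 * m < g)%N by lia.
have BNE (G : 'rV[k]_g) :
    BN_locus (m + r) r G <-> exists2 f, f != 0 & apolar g (coords G) m f.
  rewrite BN_apolar; last by lia.
  by apply: dim_ge_apolar; lia.
have closed : zariski_closed (@BN_locus k g (m + r) r).
  have [I HI] := @zariski_closed_hankel k g m.+1 (g - m) 0.
  exists I => v; rewrite BNE -HI; apply: iff_sym; apply: hankel_singular_apolar; lia.
split=> // [F HF|].
  have [|phi [psi [H1 H2]]] := cone_iso (m := m) _ HF; first by lia.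
  exists phi, psi; split=> [x /BNE|y /H2[H3 H4]]; first exact: H1.
  by split=> //; apply/BNE.
have -> : (2 * (m + r) - 2 * r = 2 * m)%N by lia.
split=> [|e Z]; last first.
  have cover v : BN_locus (m + r) r v ->
      exists (l : 'I_m.+1) x, v = polymap (@recur_poly k g m l) x.
    by move=> /BNE; apply: apolar_cover.
  exact: irreducible_chain_le cover e Z.
exists (fun j => zariski_closure (flag_image m j)).
apply: irreducible_chain_hankel => // t; apply/BNE; exact: apolar_recur_point.
Qed.
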